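(* Let $p$ be a prime greater than $2$, $m$ a positive integer, and $f \colon GF(p)^{2m} \to GF(p)$ an even function with $f(0)=0$ such that the component Cayley graphs of $f$ are of feasible degrees and $f$ determines an amorphic association scheme. Then $f$ is bent.
   Context: Let $\zeta = e^{2\pi i/p}$, identify $GF(p)$ with $\{0,\dots,p-1\}$; $W_f(x) = \sum_y \zeta^{f(y)-\langle x,y\rangle}$ ($\langle\ ,\ \rangle$ the standard inner product); $f$ is bent if $|W_f(x)| = p^m$ for all $x$. Let $D_0=\{0\}$, $D_i = f^{-1}(i)$ for $1 \le i \le p-1$, $D_p = f^{-1}(0)\setminus\{0\}$. The component Cayley graph $\Gamma_i$ ($1\le i\le p$) has vertex set $GF(p)^{2m}$, distinct $x,y$ adjacent iff $x-y\in D_i$; it is regular of degree $|D_i|$. The graphs are of feasible degrees if $\deg \Gamma_i = (N-1)r_i$ for all $1 \le i \le p$, where $N$ is one of $p^m$ or $-p^m$ (the same for all $i$), $r_i = N/p$ for $1 \le i \le p-1$, and $r_p = N/p+1$. On $V = GF(p)^{2m}$ let $R_i = \{(x,y)\mid x-y\in D_i\}$ for $0\le i\le p$. A partition $\{S_0,\dots,S_d\}$ of $V\times V$ with $S_0$ the diagonal, each $S_i$ closed under $(x,y)\mapsto(y,x)$, forms an association scheme if for all $i,j,k$ the number $|\{z \mid (x,z)\in S_i, (z,y)\in S_j\}|$ is the same for all $(x,y)\in S_k$. $f$ determines an amorphic association scheme if $\{R_0,\dots,R_p\}$ forms an association scheme and every fusion of it also forms an association scheme, where a fusion is a partition $\{T_0,\dots,T_d\}$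 of $V\times V$ in which each $T_l$ is a union of some of the $R_i$. *)

(* Defs.v *)
From HB Require Import structures.
From mathcomp Require Import all_boot all_order all_algebra.
From mathcomp Require Import complex.
From mathcomp Require Import all_classical all_reals all_analysis.

Set Implicit Arguments.
Unset Strict Implicit.
Unset Printing Implicit Defensive.

Import Order.TTheory GRing.Theory Num.Theory.

Local Open Scope ring_scope.

Definition zeta (R : realType) (p : nat) : R[i] :=
  (cos (2 * pi / p%:R) +i* sin (2 * pi / p%:R))%C.

Definition dotp (p n : nat) (x y : 'rV['F_p]_n) : 'F_p :=
  \sum_(i < n) x 0 i * y 0 i.

(* The exponent lives in 'F_p and is read as its representative in
   {0, ..., p-1} through the coercion of ordinals to nat. *)
Definition walsh (R : realType) (p n : nat) (f : 'rV['F_p]_n -> 'F_p)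
    (x : 'rV['F_p]_n) : R[i] :=
  \sum_(y : 'rV['F_p]_n) zeta R p ^+ (f y - dotp x y)%R.

Definition bent (R : realType) (p m : nat) (f : 'rV['F_p]_(2 * m) -> 'F_p) :
    Prop :=
  forall x, `| walsh R f x | = p%:R ^+ m.

Section ComponentGraphs.
Variables (p n : nat) (f : 'rV['F_p]_n -> 'F_p).

Definition level_set (i : 'I_p.+1) : {set 'rV['F_p]_n} :=
  if i == 0%N :> nat then [set 0]
  else if (i < p)%N then [set x | f x == i :> nat]
  else [set x | f x == 0] :\ 0.

Definition component_graph (i : 'I_p.+1) : rel 'rV['F_p]_n :=
  fun x y => (x != y) && (x - y \in level_set i).

Definition level_rel (i : 'I_p.+1) : {set 'rV['F_p]_n * 'rV['F_p]_n} :=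
  [set xy | xy.1 - xy.2 \in level_set i].

End ComponentGraphs.

Definition feasible_ratio (p : nat) (N : rat) (i : 'I_p.+1) : rat :=
  if (i < p)%N then N / p%:R else N / p%:R + 1.

Definition feasible_degrees (p m : nat) (f : 'rV['F_p]_(2 * m) -> 'F_p) :
    Prop :=
  exists N : rat,
    (N = p%:R ^+ m \/ N = - p%:R ^+ m) /\
    forall (i : 'I_p.+1), (0 < i)%N -> forall x : 'rV['F_p]_(2 * m),
      #|[set y | component_graph f i x y]|%:R = (N - 1) * feasible_ratio N i.

Section Schemes.
Variable V : finType.

Definition diagonal : {set V * V} := [set xy | xy.1 == xy.2].

(* Classes may be empty: for N = -p and m = 1 the feasible degree of the last
   component graph is 0, so the family of level relations then has an empty
   member. *)
Definition indexed_partition (d : nat) (S : 'I_d.+1 -> {set V * V}) : Prop :=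
  (forall xy, exists i, xy \in S i) /\
  (forall i j, i != j -> [disjoint S i & S j]).

Definition association_scheme (d : nat) (S : 'I_d.+1 -> {set V * V}) : Prop :=
  [/\ indexed_partition S,
      S ord0 = diagonal,
      forall i x y, (x, y) \in S i -> (y, x) \in S i &
      forall i j k, exists c : nat, forall x y, (x, y) \in S k ->
        #|[set z | ((x, z) \in S i) && ((z, y) \in S j)]| = c].

(* The class of index 0 of a fusion is the diagonal, as for any partition
   eligible to be an association scheme. *)
Definition fusion (e d : nat) (S : 'I_e.+1 -> {set V * V})
    (T : 'I_d.+1 -> {set V * V}) : Prop :=
  [/\ indexed_partition T,
      T ord0 = diagonal &
      forall l, exists A : {set 'I_e.+1}, T l = \bigcup_(i in A) S i].

Definition amorphic (e : nat) (S : 'I_e.+1 -> {set V * V}) : Prop :=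
  association_scheme S /\
  forall (d : nat) (T : 'I_d.+1 -> {set V * V}),
    fusion S T -> association_scheme T.

End Schemes.

(* Main.v *)
Require Import Defs.
From HB Require Import structures.
From mathcomp Require Import all_boot all_order all_algebra.
From mathcomp Require Import complex zify ring lra.
From mathcomp Require Import all_classical all_reals all_analysis.
Set Implicit Arguments.
Unset Strict Implicit.
Unset Printing Implicit Defensive.
Import Order.TTheory GRing.Theory Num.Theory.
Local Open Scope ring_scope.

(** For a symmetric set A let lambda_A(x) be the sum of zeta^(- <x, y>) over y
    in A.  Amorphicity makes every union of the D_i a strongly regular Cayley
    graph, so lambda_A is a root of a fixed quadratic at every x <> 0.  Fuse the
    classes to three nonempty ones: the orthogonality relations forbid an affine
    relation between lambda_1 and lambda_2 off 0, so at least three of the four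
    value pairs occur; since lambda_1 + lambda_2 = -1 - lambda_3 also takes only
    two values, lambda_i is in {M - rho_i, - rho_i}, with the value M - rho_i
    attained by exactly one i at each x <> 0.  Orthogonality then gives M^2 = |V| and
    |D_i| = (M - 1) rho_i.  Integrality of rho_i forces M = N, the sign of the
    feasible degrees, except when N = -3, where only two classes are nonempty and
    a direct positivity argument applies.  Finally W_f(x) is N times a power of
    zeta, because the sum of zeta^i r_i over 1 <= i <= p is 1. *)

(** * Three strongly regular classes *)

Section ThreeClasses.
Variables (R : realFieldType) (X : finType) (x0 : X) (v : R).
Variables (l1 l2 l3 : X -> R).
Hypotheses (v_gt0 : 0 < v)
  (k1_gt0 : 0 < l1 x0) (k2_gt0 : 0 < l2 x0) (k3_gt0 : 0 < l3 x0).
Hypothesis k_sum : 1 + l1 x0 + l2 x0 + l3 x0 = v.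
Hypothesis l_sum : forall x, x != x0 -> l1 x + l2 x + l3 x = -1.
Hypotheses (l1_sum : \sum_x l1 x = 0) (l2_sum : \sum_x l2 x = 0)
  (l3_sum : \sum_x l3 x = 0) (sum1 : \sum_(x : X) 1 = v).
Hypotheses (l11 : \sum_x l1 x * l1 x = v * l1 x0)
  (l22 : \sum_x l2 x * l2 x = v * l2 x0)
  (l12 : \sum_x l1 x * l2 x = 0) (l13 : \sum_x l1 x * l3 x = 0)
  (l23 : \sum_x l2 x * l3 x = 0).

Lemma sum_only_x0 (g : X -> R) :
  (forall x, x != x0 -> g x = 0) -> \sum_x g x = g x0.
Proof. by move=> g0; rewrite (bigD1 x0) //= big1 ?addr0. Qed.

(* Pairing the relation with [l3] shows that it also holds at [x0]; then its
   sum of squares vanishes. *)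
Lemma no_affine_relation (a b c : R) :
  (forall x, x != x0 -> a * l1 x + b * l2 x + c = 0) -> a = 0 /\ b = 0.
Proof.
move=> g0; pose g x := a * l1 x + b * l2 x + c.
have g3 : g x0 * l3 x0 = 0.
  rewrite -(@sum_only_x0 (fun x => g x * l3 x)) => [|x /g0 gx]; last first.
    by rewrite /g gx mul0r.
  under eq_bigr => x _ do rewrite /g !mulrDl -!mulrA.
  by rewrite !big_split /= -!mulr_sumr l13 l23 l3_sum !mulr0 !addr0.
have gx0 : g x0 = 0 by move/eqP: g3; rewrite mulf_eq0 (gt_eqF k3_gt0) orbF => /eqP.
have : \sum_x g x * g x = 0.
  by rewrite sum_only_x0 ?gx0 ?mulr0 // => x /g0 gx; rewrite /g gx mulr0.
have -> : \sum_x g x * g x = v * (a ^+ 2 * l1 x0 + b ^+ 2 * l2 x0 + c ^+ 2).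
  transitivity (\sum_x (a ^+ 2 * (l1 x * l1 x) + b ^+ 2 * (l2 x * l2 x)
     + c ^+ 2 * 1 + 2 * a * b * (l1 x * l2 x) + 2 * a * c * l1 x
     + 2 * b * c * l2 x)).
    by apply: eq_bigr => x _; rewrite /g; ring.
  rewrite !big_split /= -!mulr_sumr l11 l22 l12 l1_sum l2_sum sum1; ring.
move/eqP; rewrite mulf_eq0 (gt_eqF v_gt0) /= => /eqP h.
have h1 : 0 <= a ^+ 2 * l1 x0 by rewrite mulr_ge0 ?sqr_ge0 ?ltW.
have h2 : 0 <= b ^+ 2 * l2 x0 by rewrite mulr_ge0 ?sqr_ge0 ?ltW.
have h3 := sqr_ge0 c.
have /eqP : a ^+ 2 * l1 x0 = 0 by lra.
have /eqP : b ^+ 2 * l2 x0 = 0 by lra.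
rewrite !mulf_eq0 !(gt_eqF k1_gt0) !(gt_eqF k2_gt0) !orbF !orbb.
by move=> /eqP-> /eqP->.
Qed.

Variables (c1 d1 c2 d2 c3 d3 : R).
Hypotheses
  (quad1 : forall x, x != x0 -> l1 x ^+ 2 = c1 + d1 * l1 x)
  (quad2 : forall x, x != x0 -> l2 x ^+ 2 = c2 + d2 * l2 x)
  (quad3 : forall x, x != x0 -> l3 x ^+ 2 = c3 + d3 * l3 x).

(** The combination [(r - s) t ^ 2 - (t - s) r ^ 2 + (t - r) s ^ 2] annihilates affine functions, so
    it eliminates [c] and [d] and leaves a product of differences. *)
Lemma quad_root2 (c d r s t : R) : r != s ->
  r ^+ 2 = c + d * r -> s ^+ 2 = c + d * s -> t ^+ 2 = c + d * t ->
  t = r \/ t = s.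
Proof.
rewrite -subr_eq0 => rs hr hs ht.
have /eqP : (r - s) * ((t - r) * (t - s)) = 0.
  have -> : (r - s) * ((t - r) * (t - s)) =
    (r - s) * (t ^+ 2) - (t - s) * (r ^+ 2) + (t - r) * s ^+ 2 by ring.
  rewrite hr hs ht; ring.
rewrite mulf_eq0 (negbTE rs) mulf_eq0 !subr_eq0 /=.
by case/orP => /eqP; [left | right].
Qed.

Definition attained (a b : R) := exists2 x, x != x0 & l1 x = a /\ l2 x = b.

(** Without an affine relation off [x0], neither [l1] nor [l2] is constant there, so each takes
    exactly two values, and the value pairs do not lie on one line; hence at least three of the four
    pairs occur. The values are named so that the pair possibly missing is [(s1, s2)]. *)
Lemma three_patterns : exists r1 s1 r2 s2 : R,
  [/\ s1 != r1, s2 != r2,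
      forall x, x != x0 -> (l1 x = r1 \/ l1 x = s1) /\ (l2 x = r2 \/ l2 x = s2) &
      [/\ attained r1 r2, attained s1 r2 & attained r1 s2]].
Proof.
have nonconst1 a : exists2 x, x != x0 & l1 x != a.
  have [/existsP[x /andP[]]|] := boolP [exists x, (x != x0) && (l1 x != a)].
    by exists x.
  rewrite negb_exists => /forallP h.
  case: (@no_affine_relation 1 0 (- a)) => [x xx0|/eqP]; last by rewrite oner_eq0.
  by move: (h x); rewrite xx0 negbK => /eqP->; ring.
have nonconst2 a : exists2 x, x != x0 & l2 x != a.
  have [/existsP[x /andP[]]|] := boolP [exists x, (x != x0) && (l2 x != a)].
    by exists x.
  rewrite negb_exists => /forallP h.
  case: (@no_affine_relation 0 1 (- a)) => [x xx0|_ /eqP]; last by rewrite oner_eq0.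
  by move: (h x); rewrite xx0 negbK => /eqP->; ring.
have [y yx0 _] := nonconst1 (l1 x0).
have [z zx0 yz1] := nonconst1 (l1 y).
have [w wx0 yw2] := nonconst2 (l2 y).
pose a := l1 y; pose b := l1 z; pose c := l2 y; pose d := l2 w.
have val1 x : x != x0 -> l1 x = a \/ l1 x = b.
  move=> xx0; apply: (quad_root2 (c := c1) (d := d1)); rewrite ?quad1 //.
  by rewrite eq_sym.
have val2 x : x != x0 -> l2 x = c \/ l2 x = d.
  move=> xx0; apply: (quad_root2 (c := c2) (d := d2)); rewrite ?quad2 //.
  by rewrite eq_sym.
have Pac : attained a c by exists y.
have offline (s t : R) : exists2 x, x != x0 & l2 x != s * l1 x + t.
  have [/existsP[x /andP[]]|] :=
    boolP [exists x, (x != x0) && (l2 x != s * l1 x + t)]; first by exists x.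
  rewrite negb_exists => /forallP h.
  case: (@no_affine_relation s (-1) t) => [x xx0|_ /eqP]; last first.
    by rewrite oppr_eq0 oner_eq0.
  by move: (h x); rewrite xx0 negbK => /eqP->; ring.
have ba : b - a != 0 by rewrite subr_eq0.
(* The line passes through [(a, c)] and [(b, d)], so the pair at [u] must be one of the other two
   corners. *)
have [u ux0 hu] := offline ((d - c) / (b - a)) (c - (d - c) / (b - a) * a).
have hu1 : ~ (l1 u = a /\ l2 u = c).
  by move=> [ua uc]; case/eqP: hu; rewrite ua uc; ring.
have hu2 : ~ (l1 u = b /\ l2 u = d).
  by move=> [ua uc]; case/eqP: hu; rewrite ua uc; field.
have Pb : attained b c \/ attained b d.
  by case: (val2 _ zx0) => h; [left | right]; exists z.
have Pd : attained a d \/ attained b d.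
  by case: (val1 _ wx0) => h; [left | right]; exists w.
have Pu : attained a d \/ attained b c.
  case: (val1 _ ux0) (val2 _ ux0) => h [] h'; try by case: hu1.
  - by left; exists u.
  - by right; exists u.
  - by case: hu2.
have ab : b != a by [].
have cd : d != c by [].
have [h|h] : (attained b c /\ attained a d) \/
   (attained b d /\ (attained a d \/ attained b c)) by tauto.
  by exists a, b, c, d; case: h => ? ?; split=> // x xx0; split; auto.
case: h => Pbd [Pad|Pbc].
  exists a, b, d, c; split => //; first by rewrite eq_sym.
  by move=> x xx0; split; [|case: (val2 x xx0)]; auto.
exists b, a, c, d; split => //; first by rewrite eq_sym.
by move=> x xx0; split; [case: (val1 x xx0)|]; auto.
Qed.

(** The pairs [(r1, r2)] and [(s1, r2)] already give the two values of [l3]. Then [(r1, s2)] must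
    repeat the second one, so both gaps equal a common [N], and [(s1, s2)] would give a third value,
    so it never occurs. *)
Lemma latin_square_pattern : exists N rho1 rho2 : R,
  [/\ N != 0,
      forall x, x != x0 -> (l1 x + rho1) * (l1 x + rho1 - N) = 0,
      forall x, x != x0 -> (l2 x + rho2) * (l2 x + rho2 - N) = 0,
      forall x, x != x0 -> (l1 x + rho1) * (l2 x + rho2) = 0 &
      d1 = N - 2 * rho1 /\ c1 = rho1 * (N - rho1)].
Proof.
have [r1 [s1 [r2 [s2 [sr1 sr2 val [[x xx0 [x1 x2]] [y yx0 [y1 y2]] [z zx0 [z1 z2]]]]]]]]
  := three_patterns.
have l3E u : u != x0 -> l3 u = -1 - l1 u - l2 u by move=> /l_sum <-; ring.
have N12 : s2 - r2 = s1 - r1.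
  have [] : l3 z = l3 x \/ l3 z = l3 y.
  - apply: (quad_root2 (c := c3) (d := d3)); rewrite ?quad3 //.
    rewrite !l3E // x1 x2 y1 y2; apply: contra_neq sr1 => h; lra.
  - by rewrite !l3E // x1 x2 z1 z2 => h; case/eqP: sr2; lra.
  - by rewrite !l3E // y1 y2 z1 z2 => h; lra.
exists (s1 - r1), (- r1), (- r2); split.
- by rewrite subr_eq0.
- by move=> u ux0; case: (val u ux0) => -[] -> _; ring.
- by move=> u ux0; rewrite -N12; case: (val u ux0) => _ [] ->; ring.
- move=> u ux0; case: (val u ux0) => -[] u1 [] u2; rewrite u1 u2; try ring.
  have [] : l3 u = l3 x \/ l3 u = l3 y.
  - apply: (quad_root2 (c := c3) (d := d3)); rewrite ?quad3 //.
    rewrite !l3E // x1 x2 y1 y2; apply: contra_neq sr1 => h; lra.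
  - by rewrite !l3E // x1 x2 u1 u2 => h; case/eqP: sr2; lra.
  - by rewrite !l3E // y1 y2 u1 u2 => h; case/eqP: sr2; lra.
- have q1 := quad1 xx0; have q2 := quad1 yx0.
  rewrite x1 in q1; rewrite y1 in q2.
  have dE : d1 = s1 + r1.
    apply: (@mulfI _ (s1 - r1)); first by rewrite subr_eq0.
    have -> : (s1 - r1) * d1 = (c1 + d1 * s1) - (c1 + d1 * r1) by ring.
    by rewrite -q1 -q2; ring.
  split; first by rewrite dE; ring.
  have -> : c1 = r1 ^+ 2 - d1 * r1 by rewrite q1; ring.
  rewrite dE; ring.
Qed.

(** Products of two shifted eigenvalue functions vanish off [x0], so orthogonality gives [(k_i +
    rho_i) (k_j + rho_j) = v rho_i rho_j] for the values [k_i] at [x0]. The ratios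
    [(k_i + rho_i) / rho_i] thus have pairwise products [v], which makes them equal with square
    [v]. *)
Theorem three_class_eigenvalues : exists N rho1 rho2 : R,
  [/\ N ^+ 2 = v, l1 x0 = (N - 1) * rho1, l2 x0 = (N - 1) * rho2,
      forall x, x != x0 -> (l2 x + rho2) * (l2 x + rho2 - N) = 0 &
      d1 = N - 2 * rho1 /\ c1 = rho1 * (N - rho1)].
Proof.
have [N [p1 [p2 [N0 v1 v2 v12 [dE cE]]]]] := latin_square_pattern.
(* With this choice the three shifted functions add up to [N] off [x0]. *)
pose p3 := N + 1 - p1 - p2.
have l3E u : u != x0 -> l3 u = -1 - l1 u - l2 u by move=> /l_sum <-; ring.
have v13 x : x != x0 -> (l1 x + p1) * (l3 x + p3) = 0.
  move=> xx0; rewrite l3E // -[RHS]oppr0 -(v1 x xx0) -[RHS]subr0 -(v12 x xx0).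
  rewrite /p3; ring.
have v23 x : x != x0 -> (l2 x + p2) * (l3 x + p3) = 0.
  move=> xx0; rewrite l3E // -[RHS]oppr0 -(v2 x xx0) -[RHS]subr0 -(v12 x xx0).
  rewrite /p3; ring.
have orth (l l' : X -> R) (a b : R) :
    \sum_x l x = 0 -> \sum_x l' x = 0 -> \sum_x l x * l' x = 0 ->
    (forall x, x != x0 -> (l x + a) * (l' x + b) = 0) ->
    (l x0 + a) * (l' x0 + b) = v * (a * b).
  move=> s s' ss' /(@sum_only_x0 (fun x => (l x + a) * (l' x + b))) <-.
  transitivity (\sum_x (l x * l' x + b * l x + a * l' x + a * b * 1)).
    by apply: eq_bigr => x _; ring.
  by rewrite !big_split /= -!mulr_sumr s s' ss' sum1; ring.
have e12 := orth _ _ _ _ l1_sum l2_sum l12 v12.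
have e13 := orth _ _ _ _ l1_sum l3_sum l13 v13.
have e23 := orth _ _ _ _ l2_sum l3_sum l23 v23.
(* If [a = 0], the first two equations force [b = - k'] and [c = - k''], and the third then gives
   [b * c = 0], against positivity. *)
have key (k k' k'' a b c : R) : 0 < k -> 0 < k' -> 0 < k'' ->
    (k + a) * (k' + b) = v * (a * b) -> (k + a) * (k'' + c) = v * (a * c) ->
    (k' + b) * (k'' + c) = v * (b * c) -> a != 0.
  move=> k0 k'0 k''0 E1 E2 E3; apply/eqP => a0; move: E1 E2.
  rewrite a0 addr0 !mul0r mulr0 => /eqP + /eqP.
  rewrite !mulf_eq0 (gt_eqF k0) /= => /eqP E1 /eqP E2.
  move/eqP: E3; rewrite E1 mul0r eq_sym !mulf_eq0 (gt_eqF v_gt0) /=.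
  case/orP => /eqP h; first by move: E1; rewrite h; lra.
  by move: E2; rewrite h; lra.
have p10 : p1 != 0 by apply: (key _ _ _ _ _ _ k1_gt0 k2_gt0 k3_gt0 e12 e13 e23).
have p20 : p2 != 0.
  by apply: (key _ _ _ _ _ _ k2_gt0 k1_gt0 k3_gt0 _ e23 e13); rewrite mulrC e12; ring.
have p30 : p3 != 0.
  by apply: (key _ _ _ _ _ _ k3_gt0 k1_gt0 k2_gt0 _ _ e12); rewrite mulrC ?e13 ?e23; ring.
set t1 := (l1 x0 + p1) / p1; set t2 := (l2 x0 + p2) / p2; set t3 := (l3 x0 + p3) / p3.
have E1 : l1 x0 = (t1 - 1) * p1 by rewrite /t1; field.
have E2 : l2 x0 = (t2 - 1) * p2 by rewrite /t2; field.
have E3 : l3 x0 = (t3 - 1) * p3 by rewrite /t3; field.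
have T12 : t1 * t2 = v.
  have -> : t1 * t2 = (l1 x0 + p1) * (l2 x0 + p2) / (p1 * p2) by rewrite /t1 /t2; field; rewrite p10 p20.
  by rewrite e12 mulfK ?mulf_neq0.
have T13 : t1 * t3 = v.
  have -> : t1 * t3 = (l1 x0 + p1) * (l3 x0 + p3) / (p1 * p3) by rewrite /t1 /t3; field; rewrite p10 p30.
  by rewrite e13 mulfK ?mulf_neq0.
have T23 : t2 * t3 = v.
  have -> : t2 * t3 = (l2 x0 + p2) * (l3 x0 + p3) / (p2 * p3) by rewrite /t2 /t3; field; rewrite p20 p30.
  by rewrite e23 mulfK ?mulf_neq0.
have v0 : v != 0 by rewrite gt_eqF.
have t30 : t3 != 0 by apply: contra_neq v0 => h; rewrite -T13 h mulr0.
have t10 : t1 != 0 by apply: contra_neq v0 => h; rewrite -T13 h mul0r.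
have t21 : t2 = t1 by apply: (mulIf t30); rewrite T13 T23.
have t31 : t3 = t1 by apply: (mulfI t10); rewrite T13 -T12 t21.
have tv : t1 ^+ 2 = v by rewrite -T12 t21 expr2.
(* The class sizes add up to [v], which reads [t ^ 2 = 1 + (t - 1) (N + 1)]; the root [t = 1] would
   make the first class empty. *)
have t1N : t1 = N.
  have h : (t1 - 1) * (t1 - N) = 0.
    have -> : (t1 - 1) * (t1 - N) = t1 ^+ 2 - (1 + (t1 - 1) * (p1 + p2 + p3)).
      by rewrite /p3; ring.
    by rewrite tv -k_sum E1 E2 E3 t21 t31; ring.
  move/eqP: h; rewrite mulf_eq0 !subr_eq0 => /orP[/eqP h|/eqP //].
  by move: k1_gt0; rewrite E1 h subrr mul0r ltxx.
by rewrite t21 in E2; rewrite t1N in tv E1 E2; exists N, p1, p2; split.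
Qed.

End ThreeClasses.

(** * Characters and eigenvalues of Cayley graphs *)

Section RootOfUnity.
Variable R : realType.

Lemma de_moivre (a : R) (n : nat) :
  (cos a +i* sin a)%C ^+ n = (cos (a *+ n) +i* sin (a *+ n))%C.
Proof.
elim: n => [|n IHn]; first by rewrite expr0 mulr0n cos0 sin0.
rewrite exprSr IHn mulrSr cosD sinD /=.
by apply/eqP; rewrite eq_complex /=; apply/andP; split; apply/eqP; ring.
Qed.

Lemma zeta_expr_p (p : nat) : (0 < p)%N -> zeta R p ^+ p = 1.
Proof.
move=> p_gt0; rewrite /zeta de_moivre -[_ *+ p]mulr_natr divfK; last first.
  by rewrite pnatr_eq0 -lt0n.
by rewrite mulr_natl cos2pi sin2pi.
Qed.

Lemma zeta_neq1 (p : nat) : (2 < p)%N -> zeta R p != 1.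
Proof.
move=> p_gt2; rewrite /zeta eq_complex /= negb_and; apply/orP; right.
have p0 : (0 : R) < p%:R by rewrite ltr0n (ltn_trans _ p_gt2).
rewrite gt_eqF // sin_gt0_pi // divr_gt0 ?mulr_gt0 ?pi_gt0 //=.
by rewrite ltr_pdivrMr // mulrC ltr_pM2l ?pi_gt0 // ltr_nat.
Qed.

Lemma conjc_zeta (p : nat) : (zeta R p)^*%C * zeta R p = 1.
Proof.
rewrite /zeta; apply/eqP; rewrite eq_complex /=; apply/andP; split; apply/eqP.
  by rewrite mulNr opprK -!expr2 cos2Dsin2.
ring.
Qed.

Lemma norm_zeta (p : nat) : `|zeta R p| = 1.
Proof.
by rewrite normc_def /zeta /= cos2Dsin2 sqrtr1.
Qed.

End RootOfUnity.

Section Characters.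
Variables (R : realType) (p n : nat).
Hypotheses (p_prime : prime p) (p_gt2 : (2 < p)%N).
Local Notation V := 'rV['F_p]_n.
Local Notation v := (#|{: V}|).

Definition addchar (a : 'F_p) : R[i] := zeta R p ^+ a.

Lemma zeta_mod (k : nat) : zeta R p ^+ (k %% p) = zeta R p ^+ k.
Proof.
rewrite [in RHS](divn_eq k p) exprD mulnC exprM zeta_expr_p ?prime_gt0 //.
by rewrite expr1n mul1r.
Qed.

Lemma addcharD a b : addchar (a + b) = addchar a * addchar b.
Proof. by rewrite /addchar -exprD -[RHS]zeta_mod /= {3}Fp_cast. Qed.

Lemma addchar0 : addchar 0 = 1.
Proof. by rewrite /addchar expr0. Qed.

Lemma addcharNK a : addchar (- a) * addchar a = 1.
Proof. by rewrite -addcharD addNr addchar0. Qed.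

Lemma conjc_addchar a : (addchar a)^*%C = addchar (- a).
Proof.
have aa : (addchar a)^*%C * addchar a = 1.
  by rewrite /addchar rmorphXn -exprMn conjc_zeta expr1n.
have a0 : addchar a != 0.
  by apply/eqP => h; move/eqP: aa; rewrite h mulr0 eq_sym oner_eq0.
by apply: (mulIf a0); rewrite aa addcharNK.
Qed.

Lemma dotpDr (x y z : V) : dotp x (y + z) = dotp x y + dotp x z.
Proof. by rewrite -big_split; apply: eq_bigr => i _; rewrite mxE mulrDr. Qed.

Lemma dotpC (x y : V) : dotp x y = dotp y x.
Proof. by apply: eq_bigr => i _; rewrite mulrC. Qed.

Lemma dotp0 (x : V) : dotp x 0 = 0.
Proof. by apply: big1 => i _; rewrite mxE mulr0. Qed.

Lemma dotpN (x y : V) : dotp x (- y) = - dotp x y.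
Proof. by apply/eqP; rewrite -addr_eq0 -dotpDr addNr dotp0. Qed.

Definition chi (x y : V) : R[i] := addchar (- dotp x y).

Lemma chiDr x y z : chi x (y + z) = chi x y * chi x z.
Proof. by rewrite /chi dotpDr opprD addcharD. Qed.

Lemma chiC x y : chi x y = chi y x.
Proof. by rewrite /chi dotpC. Qed.

Lemma chi0 x : chi x 0 = 1.
Proof. by rewrite /chi dotp0 oppr0 addchar0. Qed.

Lemma sum_chi (x : V) : \sum_y chi x y = (v * (x == 0))%:R.
Proof.
have [->|] := eqVneq x 0.
  rewrite muln1; under eq_bigr => y _ do rewrite chiC chi0.
  by rewrite sumr_const.
move=> x0; rewrite muln0; have [i xi] : exists i, x 0 i != 0.
  apply/existsP; apply: contraNT x0; rewrite negb_exists => /forallP h.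
  apply/eqP/rowP => i; rewrite mxE; apply/eqP.
  by rewrite -[_ == _]negbK; exact: h.
(* Translation by this [z] multiplies the character sum by [zeta], which differs from 1. *)
pose z : V := (- (x 0 i)^-1) *: delta_mx 0 i.
have xz : chi x z = zeta R p.
  rewrite /chi /dotp (bigD1 i) //= big1 => [|j ji]; last first.
    by rewrite !mxE (negbTE ji) andbF !mulr0.
  rewrite !mxE !eqxx mulr1 addr0 mulrN opprK divff //.
have : (zeta R p - 1) * \sum_y chi x y = 0.
  rewrite mulrBl mul1r [X in _ - X](reindex_inj (addrI z)) /=.
  apply/eqP; rewrite subr_eq0 mulr_sumr; apply/eqP; apply: eq_bigr => y _.
  by rewrite chiDr xz.
by move/eqP; rewrite mulf_eq0 subr_eq0 (negbTE (zeta_neq1 _ _)) //= => /eqP.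
Qed.

Definition eigenC (A : {set V}) (x : V) : R[i] := \sum_(y in A) chi x y.

(** Taking the real part places the eigenvalues in an ordered field; for symmetric sets nothing is
    lost, by [eigenE]. *)
Definition eigen (A : {set V}) (x : V) : R := complex.Re (eigenC A x).

Definition symset (A : {set V}) := forall y, (- y \in A) = (y \in A).

Lemma eigenE (A : {set V}) x : symset A -> ((eigen A x)%:C)%C = eigenC A x.
Proof.
move=> sA; suff : (eigenC A x)^*%C = eigenC A x.
  rewrite /eigen; case: (eigenC A x) => a b /eqP; rewrite eq_complex /= eqxx /=.
  move=> /eqP h; congr (_ +i* _)%C; lra.
rewrite /eigenC rmorph_sum (reindex_inj oppr_inj) /=.
apply: eq_big => [y|y _]; first exact: sA.
by rewrite /chi conjc_addchar dotpN opprK.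
Qed.

Lemma eigenC0 (A : {set V}) : eigenC A 0 = #|A|%:R.
Proof.
by rewrite /eigenC; under eq_bigr => y _ do rewrite chiC chi0; rewrite sumr_const.
Qed.

Lemma natC k : ((k%:R : R)%:C)%C = k%:R.
Proof. exact: rmorph_nat. Qed.

Lemma eigen0 (A : {set V}) : eigen A 0 = #|A|%:R.
Proof. by rewrite /eigen eigenC0 -natC. Qed.

Lemma sum_eigenC (A : {set V}) : \sum_x eigenC A x = (v * (0 \in A))%:R.
Proof.
rewrite /eigenC exchange_big /=.
under eq_bigr => y _.
  under eq_bigr => x _ do rewrite chiC.
  rewrite sum_chi; over.
have [h|h] := boolP (0 \in A).
  rewrite (bigD1 0) //= eqxx big1 ?addr0 // => y /andP[_ /negbTE->].
  by rewrite muln0.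
by rewrite big1 ?muln0 // => y yA; case: eqP yA h => [->->//|]; rewrite muln0.
Qed.

Lemma sum_eigen (A : {set V}) : symset A -> 0 \notin A -> \sum_x eigen A x = 0.
Proof.
move=> sA A0; apply: complexI; rewrite rmorph_sum /=.
under eq_bigr => x _ do rewrite eigenE //.
by rewrite sum_eigenC (negbTE A0) muln0.
Qed.

(** This is Parseval: summing [chi x (y + z)] over [x] leaves only [z = - y], and symmetry of [B]
    turns this into [y \in B]. *)
Lemma sum_eigenM (A B : {set V}) : symset A -> symset B ->
  \sum_x eigen A x * eigen B x = v%:R * #|A :&: B|%:R.
Proof.
move=> sA sB; apply: complexI; rewrite rmorph_sum -natrM /= natC.
under eq_bigr => x _ do rewrite rmorphM /= !eigenE // /eigenC big_distrlr /=.
rewrite exchange_big /=.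
under eq_bigr => y yA.
  rewrite exchange_big /=.
  under eq_bigr => z zB.
    under eq_bigr => x _ do rewrite -chiDr chiC.
    rewrite sum_chi; over.
  over.
rewrite natrM -[X in _ = _ * X]sumr_const mulr_sumr /=.
rewrite [RHS](eq_bigl (fun y => (y \in A) && (y \in B))) => [|y]; last by rewrite inE.
rewrite big_mkcondr /=; apply: eq_bigr => y yA.
have [yB|yB] := boolP (y \in B).
  rewrite (bigD1 (- y)) ?sB //= subrr eqxx big1 ?addr0 ?mulr1 ?muln1 //.
  move=> z /andP[_]; rewrite -addr_eq0 addrC => /negbTE->.
  by rewrite muln0.
apply: big1 => z zB; case: eqP => [h|_]; rewrite ?muln0 //.
by move: yB; rewrite -sB (addr0_eq h) zB.
Qed.

Lemma eigen_setT (x : V) : x != 0 -> eigen [set: V] x = 0.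
Proof.
move=> x0; rewrite /eigen /eigenC (eq_bigl xpredT) => [|y]; last by rewrite inE.
by rewrite sum_chi (negbTE x0) muln0.
Qed.

Lemma eigen_set1 x : eigen [set 0] x = 1.
Proof. by rewrite /eigen /eigenC big_set1 chi0. Qed.

Lemma eigenU (A B : {set V}) x : [disjoint A & B] ->
  eigen (A :|: B) x = eigen A x + eigen B x.
Proof.
move=> AB; rewrite /eigen /eigenC (eq_bigl [predU A & B]) => [|y]; last first.
  by rewrite !inE.
rewrite bigU //=; case: (\sum_(_ in A) _) => ? ?.
by case: (\sum_(_ in B) _).
Qed.

(** The count is the convolution square of the indicator of [A], whose transform is the squared
    eigenvalue. By [cnt] it is a combination of the constant 1, the indicator of [A] and the point
    mass at 0; the constant transforms to 0 at [x != 0]. *)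
Lemma eigen_quad (A : {set V}) (l m : nat) (x : V) : symset A -> 0 \notin A ->
  (forall w : V, w != 0 ->
    #|[set z in A | w - z \in A]| = if w \in A then l else m) -> x != 0 ->
  eigen A x ^+ 2 = (#|A|%:R - m%:R) + (l%:R - m%:R) * eigen A x.
Proof.
move=> sA A0 hA x0; apply: complexI.
rewrite rmorphXn rmorphD rmorphM !rmorphB /= !natC eigenE //.
have cnt (w : V) : (#|[set z in A | w - z \in A]|%:R : R[i]) =
    m%:R + (l%:R - m%:R) * (w \in A)%:R + (#|A|%:R - m%:R) * (w == 0)%:R.
  have [->|w0] := eqVneq w 0.
    rewrite (negbTE A0) mulr0 addr0 mulr1 addrC subrK; congr (_%:R).
    by apply: eq_card => z; rewrite inE sub0r sA andbb.
  by rewrite hA // mulr0 addr0; case: (w \in A); rewrite /= ?mulr1 ?mulr0; ring.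
rewrite expr2 {1 2}/eigenC big_distrlr /=.
transitivity (\sum_w chi x w * #|[set z in A | w - z \in A]|%:R).
  under [RHS]eq_bigr => w _.
    rewrite -sumr_const mulr_sumr.
    under eq_bigl => z do rewrite inE.
    over.
  rewrite /= [RHS](exchange_big_dep (mem A)) /=; last by move=> w z _ /andP[].
  apply: eq_bigr => z zA; rewrite [RHS](reindex_inj (addrI z)) /=.
  apply: eq_big => [y|y _]; first by rewrite zA addrAC subrr add0r.
  by rewrite chiDr mulr1.
under eq_bigr => w _ do rewrite cnt !mulrDr.
rewrite !big_split /= -mulr_suml sum_chi (negbTE x0) muln0 mul0r add0r addrC.
congr (_ + _).
  rewrite (bigD1 0) //= chi0 eqxx big1 ?addr0 ?mulr1 ?mul1r // => w /negbTE->.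
  by rewrite !mulr0.
rewrite /eigenC mulr_sumr [RHS]big_mkcond /=; apply: eq_bigr => w _.
by case: (w \in A); rewrite ?mulr1 ?mulr0 // mulrC.
Qed.

End Characters.

(** * Level sets of an amorphic function *)

(** Apply amorphicity to the fusion with three classes: the diagonal, [U] and all the rest. *)
Lemma amorphic_srg (V : finType) (e : nat) (S : 'I_e.+1 -> {set V * V})
    (I : {set 'I_e.+1}) (U := \bigcup_(i in I) S i) :
  amorphic S -> ord0 \notin I ->
  exists l m : nat, forall x y, x != y ->
    #|[set z | ((x, z) \in U) && ((z, y) \in U)]| = if (x, y) \in U then l else m.
Proof.
move=> [[[cover disj] S0 _ _] fus] I0.
pose g (i : 'I_e.+1) : 'I_3 :=
  if i == ord0 then 0 else if i \in I then 1 else 2%:R.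
pose T (j : 'I_3) := \bigcup_(i in [set i | g i == j]) S i.
have gI i : (g i == 1) = (i \in I).
  rewrite /g; case: (eqVneq i ord0) => [->|_]; first by rewrite (negbTE I0).
  by case: (i \in I).
have T1 : T 1 = U.
  by apply: eq_bigl => i; rewrite inE gI.
have T0 : T ord0 = Defs.diagonal V.
  rewrite -S0 /T (eq_bigl (pred1 ord0)) ?big_pred1_eq // => i.
  by rewrite inE /g /=; case: (eqVneq i ord0) => // _; case: (i \in I).
have in_T xy i : xy \in S i -> xy \in T (g i).
  by move=> h; apply/bigcupP; exists i; rewrite ?inE.
have T_in xy j : xy \in T j -> exists2 i, g i = j & xy \in S i.
  by move=> /bigcupP[k]; rewrite inE => /eqP; exists k.
have fT : fusion S T.
  split => //.
  - split => [xy|j k jk].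
      by have [i /in_T h] := cover xy; exists (g i).
    apply/pred0P => xy /=; apply/negP => /andP[/T_in[i gi xi] /T_in[i' gi' xi']].
    have ii' : i = i'.
      apply/eqP; apply: contraTT xi' => /disj/disjoint_setI0/setP/(_ xy).
      by rewrite !inE xi /= => ->.
    by move: jk; rewrite -gi -gi' ii' eqxx.
  - by move=> j; exists [set i | g i == j].
have [_ _ _ cst] := fus _ _ fT.
have [l hl] := cst 1 1 1; have [m hm] := cst 1 1 2%:R.
rewrite T1 in hl hm.
exists l, m => x y xy; case: ifP => xyU; first exact: hl.
apply: hm; have [i xyi] := cover (x, y).
suff <- : g i = 2%:R by exact: in_T.
rewrite /g; case: eqP => [i0|_].
  by move: xyi xy; rewrite i0 S0 inE /= => ->.
by case: ifP => // iI; move: xyU; rewrite (_ : _ \in U) //; apply/bigcupP; exists i.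
Qed.

(** * Integrality and the sign of the eigenvalue gap *)

Lemma mulz_nat_ge3 (q : int) (p : nat) :
  (2 < p)%N -> q != 0 -> q * p%:Z >= 3 \/ q * p%:Z <= -3.
Proof.
move=> p_gt2 q0; have [h|h] : q >= 1 \/ q <= -1 by lia.
  by left; nia.
by right; nia.
Qed.

(* The eigenvalues are roots of an integral quadratic, so [rho] is an integer;
   this rules out [M = - q p]. *)
Lemma latin_sign (R : realFieldType) (p : nat) (q c d : int) (M rho : R) :
  (2 < p)%N -> q != 0 -> q * p%:Z != -3 ->
  M ^+ 2 = (q * p%:Z)%:~R ^+ 2 ->
  ((q * p%:Z - 1) * q)%:~R = (M - 1) * rho ->
  d%:~R = M - 2 * rho -> c%:~R = rho * (M - rho) -> M = (q * p%:Z)%:~R.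
Proof.
move=> p_gt2 q0 N3 M2 kE dE cE.
move/eqP: M2; rewrite eqf_sqr => /orP[/eqP//|/eqP ME].
exfalso; set N := q * p%:Z in N3 ME kE.
have rhoE : 2 * rho = (- N - d)%:~R by rewrite rmorphB rmorphN /= dE ME; ring.
have cu : 4 * c = (- N - d) * (- 2 * N - (- N - d)).
  apply: (@intr_inj R).
  have -> : (4 * c)%:~R = 4 * (c%:~R : R) by rewrite rmorphM.
  have -> : ((- N - d) * (- 2 * N - (- N - d)))%:~R =
     (2 * rho) * (2 * M - 2 * rho) :> R.
    rewrite rmorphM /= -rhoE [(- 2 * N - _)%:~R]rmorphB /= -rhoE ME.
    by rewrite rmorphM /=; ring.
  by rewrite cE; ring.
have ku : (N + 1) * (- N - d) = - (2 * ((N - 1) * q)).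
  apply: (@intr_inj R); rewrite rmorphM rmorphN /= -rhoE.
  rewrite rmorphM /= kE ME rmorphD /=; ring.
(* An odd [u = - N - d] would make [u * (- 2 * N - u)] odd, while [cu] says that it is [4 * c]; so
   [rho] is the integer [z]. *)
have [z zE] : exists z, - N - d = 2 * z.
  exists ((- N - d) %/ 2)%Z; move: cu; set u := - N - d => cu.
  have : (u %% 2)%Z = 0 \/ (u %% 2)%Z = 1 by lia.
  case=> h; first by lia.
  exfalso; have [w uE] : exists w, u = 2 * w + 1 by exists (u %/ 2)%Z; lia.
  rewrite uE in cu; nia.
have kz : (N + 1) * z = - ((N - 1) * q) by rewrite zE in ku; lia.
(* Since [N] is [q * p], the relation [kz] shows that [q] divides [z]. The quotient [w] satisfies
   [(N + 1) * (w + 1) = 2], which is impossible once [N + 1] exceeds 2 in absolute value. *)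
have zq : z = q * (- (N - 1) - p%:Z * z) by move: kz; rewrite /N; lia.
set w := - (N - 1) - p%:Z * z in zq.
have wE : (N + 1) * w = - (N - 1).
  by apply: (mulfI q0); move: kz; rewrite zq; lia.
have Nbig : N >= 3 \/ N <= -4 by have := mulz_nat_ge3 p_gt2 q0; rewrite -/N; lia.
have : (N + 1) * (w + 1) = 2 by lia.
have : w + 1 >= 1 \/ w + 1 = 0 \/ w + 1 <= -1 by lia.
move: (w + 1) => t; clear - Nbig; move: Nbig; move: N => M.
by case=> ? [?|[->|?]]; nia.
Qed.

(** * Eigenvalues of the level sets and Walsh coefficients *)

Section LevelSets.
Variables (R : realType) (p n : nat) (f : 'rV['F_p]_n -> 'F_p).
Hypotheses (p_prime : prime p) (p_gt2 : (2 < p)%N).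
Hypotheses (f_even : forall x, f (- x) = f x) (f0 : f 0 = 0).
Hypothesis f_amorphic : amorphic (level_rel f).
Local Notation V := 'rV['F_p]_n.
Local Notation D := (level_set f).

(** The level sets are the fibres of this map, by [in_level_set], so disjointness and covering
    reduce to comparing indices. *)
Definition level (y : V) : 'I_p.+1 :=
  inord (if y == 0 then 0 else if f y == 0 then p else f y).

Lemma ltn_Fp (a : 'F_p) : (a < p)%N.
Proof. by have := ltn_ord a; rewrite [X in (_ < X)%N -> _]Fp_cast. Qed.

Lemma val_level (y : V) :
  level y = (if y == 0 then 0 else if f y == 0 then p else f y) :> nat.
Proof.
rewrite /level inordK //; case: eqP => // _; case: eqP => // _.
by rewrite ltnS ltnW // ltn_Fp.
Qed.

Lemma in_level_set i (y : V) : (y \in D i) = (level y == i).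
Proof.
rewrite -val_eqE /= val_level /level_set; have := ltn_Fp (f y).
case: ifP => [/eqP->|/negbT i0].
  rewrite inE; case: (y == 0) => // _; case: (eqVneq (f y) 0) => [_|fy0].
    by rewrite eqn0Ngt prime_gt0.
  by apply/esym; apply: contraNF fy0 => /eqP h; apply/eqP/val_inj.
move=> fyp; case: ifP => ip.
  rewrite inE; have [->|_] := eqVneq y 0; first by rewrite f0.
  have [->|//] := eqVneq (f y) 0.
  by rewrite (gtn_eqF ip) eq_sym /= (negbTE i0).
have ->: i = p :> nat by move: (ltn_ord i); rewrite ltnS => h; apply/eqP; rewrite eqn_leq h leqNgt ip.
rewrite !inE; have [->|_] /= := eqVneq y 0; first by rewrite eq_sym eqn0Ngt prime_gt0.
by have [_|_] := eqVneq (f y) 0; rewrite ?eqxx // ltn_eqF.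
Qed.

Lemma level_set0 : D ord0 = [set 0].
Proof. by []. Qed.

Lemma zero_notin_level (i : 'I_p.+1) : (0 < i)%N -> 0 \notin D i.
Proof.
by move=> i0; rewrite in_level_set -val_eqE /= val_level eqxx eq_sym -lt0n.
Qed.

Lemma symset_level i : symset (D i).
Proof.
by move=> y; rewrite !in_level_set -!val_eqE /= !val_level oppr_eq0 f_even.
Qed.

Definition level_union (I : {set 'I_p.+1}) : {set V} := [set y | level y \in I].

Lemma level_union1 i : level_union [set i] = D i.
Proof. by apply/setP => y; rewrite !inE in_level_set. Qed.

Lemma symset_level_union I : symset (level_union I).
Proof.
move=> y; rewrite !inE; congr (_ \in I); apply/val_inj => /=.
by rewrite !val_level oppr_eq0 f_even.
Qed.

Lemma zero_notin_level_union (I : {set 'I_p.+1}) :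
  ord0 \notin I -> 0 \notin level_union I.
Proof.
apply: contra; rewrite inE (_ : level 0 = ord0) //.
by apply/val_inj; rewrite /= val_level eqxx.
Qed.

Lemma eigen_level_union (I : {set 'I_p.+1}) : ord0 \notin I ->
  exists l m : nat, forall x : V, x != 0 ->
    eigen R (level_union I) x ^+ 2 =
    (#|level_union I|%:R - m%:R) + (l%:R - m%:R) * eigen R (level_union I) x.
Proof.
move=> I0; have [l [m h]] := amorphic_srg f_amorphic I0.
have inU (xy : V * V) : (xy \in \bigcup_(i in I) level_rel f i)
    = (xy.1 - xy.2 \in level_union I).
  apply/bigcupP/idP => [[i iI]|h'].
    by rewrite inE in_level_set !inE => /eqP->.
  rewrite inE in h'; exists (level (xy.1 - xy.2)) => //.
  by rewrite inE in_level_set.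
exists l, m => x x0; apply: eigen_quad => //.
- exact: symset_level_union.
- exact: zero_notin_level_union.
(* The parameters of the strongly regular graph are read off at the pairs [(w, 0)]. *)
- move=> w w0; have := h w 0 w0; rewrite inU /= subr0 => <-.
  apply: eq_card => z; rewrite [RHS]inE !inU /= subr0 !inE.
  by rewrite andbC.
Qed.

Lemma eigen_levelE i (x : V) : ((eigen R (D i) x)%:C)%C = eigenC R (D i) x.
Proof. by apply: eigenE => //; exact: symset_level. Qed.

Lemma sum_eigen_level (x : V) : x != 0 -> \sum_i eigen R (D i) x = 0.
Proof.
move=> x0; apply: complexI; rewrite rmorph_sum rmorph0 /=.
under eq_bigr => i _ do rewrite eigen_levelE.
transitivity (\sum_y chi R x y); last first.
  by rewrite sum_chi // (negbTE x0) muln0.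
rewrite (partition_big level predT) //=; apply: eq_bigr => i _.
by apply: eq_bigl => y; rewrite in_level_set.
Qed.

(** The index of a level agrees with the value of [f] modulo [p]: index [p] stands for the value 0,
    and [zeta R p ^+ p = 1]. *)
Lemma walsh_level (x : V) :
  walsh R f x = \sum_(i < p.+1) zeta R p ^+ i * ((eigen R (D i) x)%:C)%C.
Proof.
rewrite /walsh (partition_big level predT) //=; apply: eq_bigr => i _.
rewrite eigen_levelE /eigenC mulr_sumr; apply: eq_big => [y|y /eqP <-].
  by rewrite in_level_set.
rewrite -/(addchar R (f y - dotp x y)) addcharD //; congr (_ * _).
rewrite /addchar val_level; case: eqP => [->|_]; first by rewrite f0.
by case: eqP => // ->; rewrite zeta_expr_p ?prime_gt0 // expr0.
Qed.

(* [q * p] is the [N] of the feasible degrees, with ratios [r_i = q + (i == p)]. *)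
Variable q : int.
Hypotheses (q0 : q != 0) (card_v : (#|{: V}|)%:Z = (q * p%:Z) ^+ 2).
Hypothesis degD : forall i : 'I_p.+1, (0 < i)%N ->
  #|D i|%:Z = (q * p%:Z - 1) * (q + (i == p :> nat)%:Z).
Local Notation N := (q * p%:Z).

Lemma subN1_neq0 : N - 1 != 0.
Proof. by have := mulz_nat_ge3 p_gt2 q0; lia. Qed.

Lemma card_vR : (#|{: V}|)%:R = (N%:~R : R) ^+ 2.
Proof. by rewrite -rmorphXn -card_v. Qed.

Lemma degDR (i : 'I_p.+1) : (0 < i)%N ->
  #|D i|%:R = (N%:~R - 1) * (q + (i == p :> nat)%:Z)%:~R :> R.
Proof. by move=> /degD h; rewrite -[1]/(1%:~R) -rmorphB -rmorphM -h. Qed.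

(** Apply the three-class theorem to [D j], [D i] and the remaining nonzero vectors. The class
    [D j], of ratio [q], fixes the sign of [M] through [latin_sign]; the degree of [D i] then
    determines [rho2]. *)
Lemma level_eigenvalues_generic (i : 'I_p.+1) (x : V) :
  N != -3 -> (0 < i)%N -> x != 0 ->
  (eigen R (D i) x + (q + (i == p :> nat)%:Z)%:~R) *
  (eigen R (D i) x + (q + (i == p :> nat)%:Z)%:~R - N%:~R) = 0.
Proof.
(* An empty [D i] has eigenvalue 0 and, by its degree, ratio 0, so the first factor vanishes. *)
have N1 := subN1_neq0; move=> N3 i0 x0; have [Di|Di] := posnP #|D i|.
  have r0 : q + (i == p :> nat)%:Z = 0.
    by apply: (mulfI N1); rewrite -degD // Di mulr0.
  rewrite /eigen /eigenC (cards0_eq Di) big_set0 r0; ring.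
pose j : 'I_p.+1 := if i == 1%N :> nat then inord 2 else inord 1.
have [j0 jp ij] : [/\ (0 < j)%N, (j < p)%N & i != j].
  by rewrite -val_eqE /= /j; case: eqP => h; rewrite inordK; try split; lia.
pose A3 := level_union (~: [set ord0; j; i]).
have U1 (k : 'I_p.+1) : (0 < k)%N -> ord0 \notin [set k].
  by move=> k0; rewrite inE -val_eqE /= eq_sym -lt0n.
have U3 : ord0 \notin ~: [set ord0; j; i] by rewrite !inE eqxx.
have sA3 : symset A3 := @symset_level_union _.
have zA3 : 0 \notin A3 := zero_notin_level_union U3.
have sDj := symset_level j; have sDi := symset_level i.
have zDj := zero_notin_level j0; have zDi := zero_notin_level i0.
have dij : [disjoint D j & D i].
  apply/pred0P => y /=; rewrite !in_level_set; apply/negP => /andP[/eqP-> /eqP h].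
  by rewrite h eqxx in ij.
have dj3 : [disjoint D j & A3].
  apply/pred0P => y /=; rewrite in_level_set !inE; apply/negP => /andP[/eqP->].
  by rewrite eqxx orbT.
have di3 : [disjoint D i & A3].
  apply/pred0P => y /=; rewrite in_level_set !inE; apply/negP => /andP[/eqP->].
  by rewrite eqxx orbT.
have dji3 : [disjoint D j :|: D i & A3].
  by rewrite -setI_eq0 finset.setIUl !disjoint_setI0 ?finset.setU0.
have d0 : [disjoint [set 0] & D j :|: D i :|: A3].
  by rewrite disjoints1 !finset.in_setU !negb_or zDj zDi zA3.
have total : [set: V] = [set 0] :|: (D j :|: D i :|: A3).
  apply/setP => y; rewrite finset.in_setT !finset.in_setU -level_set0.
  rewrite !in_level_set !inE.
  by case: (level y == ord0); case: (level y == j); case: (level y == i).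
have cards : (#|{: V}| = 1 + #|D j| + #|D i| + #|A3|)%N.
  rewrite -cardsT total; have cU (A B : {set V}) : [disjoint A & B] ->
      #|A :|: B| = (#|A| + #|B|)%N by move=> /disjoint_setI0 h; rewrite cardsU h cards0 subn0.
  by rewrite !cU // cards1 !addnA.
have kj := degD j0; have ki := degD i0; rewrite (ltn_eqF jp) addr0 in kj.
have k3 : #|A3|%:Z = (N - 1) * (N + 1 - 2 * q - (i == p :> nat)%:Z).
  have -> : #|A3|%:Z = (#|{: V}|)%:Z - 1 - #|D j|%:Z - #|D i|%:Z by rewrite cards !PoszD; ring.
  by rewrite card_v kj ki; ring.
have kj_gt0 : (0 < #|D j|)%N.
  by rewrite lt0n; apply: contra_neq (mulf_neq0 N1 q0) => h; rewrite -kj h.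
have k3_gt0 : (0 < #|A3|)%N.
  (* The expression equals [q * (p - 2) + 1], less 1 if [i = p]. With [p > 2] and [q != 0] it
     vanishes only for [p = 3], [q = -1] and [i < p], where [N = -3]. *)
  have f3 : N + 1 - 2 * q - (i == p :> nat)%:Z != 0.
    have [h|[h|h]] : q >= 1 \/ q = -1 \/ q <= -2 by clear - q0; lia.
    - by clear - h p_gt2; case: (i == p :> nat); nia.
    - by clear - h p_gt2 N3; case: (i == p :> nat); nia.
    - by clear - h p_gt2; case: (i == p :> nat); nia.
  rewrite lt0n; apply: contra_neq (mulf_neq0 N1 f3) => h.
  by rewrite -k3 h.
have [lj [mj qj]] := eigen_level_union (U1 j j0).
have [li [mi qi]] := eigen_level_union (U1 i i0).
have [l3 [m3 q3]] := eigen_level_union U3.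
rewrite !level_union1 in qj qi; rewrite -/A3 in q3.
have orth (A B : {set V}) : symset A -> symset B -> [disjoint A & B] ->
    \sum_x eigen R A x * eigen R B x = 0.
  by move=> sA sB /disjoint_setI0 AB; rewrite sum_eigenM // AB cards0 mulr0.
have gt0R (A : {set V}) : (0 < #|A|)%N -> 0 < eigen R A 0.
  by rewrite eigen0 ltr0n.
have v_gt0 : 0 < (#|{: V}|%:R : R) by rewrite ltr0n cards.
have k_sum : 1 + eigen R (D j) 0 + eigen R (D i) 0 + eigen R A3 0 = #|{: V}|%:R.
  by rewrite !eigen0 cards !natrD.
have l_sum (y : V) : y != 0 -> eigen R (D j) y + eigen R (D i) y + eigen R A3 y = -1.
  move=> y0; apply/eqP; rewrite -addr_eq0 addrC.
  have := eigen_setT R p_prime p_gt2 y0.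
  by rewrite total !eigenU // eigen_set1 // => ->.
have sum1 : \sum_(y : V) (1 : R) = #|{: V}|%:R by rewrite sumr_const.
have sq (A : {set V}) : symset A ->
    \sum_y eigen R A y * eigen R A y = #|{: V}|%:R * eigen R A 0.
  by move=> sA; rewrite sum_eigenM // finset.setIid eigen0.
have [M [rho1 [rho2 [M2 K1 K2 val [d1E c1E]]]]] :=
  three_class_eigenvalues v_gt0 (gt0R _ kj_gt0) (gt0R _ Di) (gt0R _ k3_gt0)
    k_sum l_sum (sum_eigen R p_prime p_gt2 sDj zDj)
    (sum_eigen R p_prime p_gt2 sDi zDi) (sum_eigen R p_prime p_gt2 sA3 zA3)
    sum1 (sq _ sDj) (sq _ sDi) (orth _ _ sDj sDi dij) (orth _ _ sDj sA3 dj3)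
    (orth _ _ sDi sA3 di3) qj qi q3.
rewrite !eigen0 in K1 K2.
have ME : M = N%:~R.
  apply: (latin_sign (c := #|D j|%:Z - mj%:Z) (d := lj%:Z - mj%:Z) (rho := rho1)) => //.
  - by rewrite M2 card_vR.
  - by rewrite -K1 -kj.
  - by rewrite -d1E rmorphB.
  - by rewrite -c1E rmorphB.
have N1R : (N%:~R - 1 : R) != 0.
  by rewrite -[1]/(1%:~R) -rmorphB intr_eq0.
have rE : rho2 = (q + (i == p :> nat)%:Z)%:~R.
  by apply: (mulfI N1R); rewrite -degDR // K2 ME.
by have := val x x0; rewrite rE ME.
Qed.

(** On the unit circle the real part [a] of a cube root of 1 satisfies
    [(a - 1) (2 a + 1) ^ 2 = 0]. *)
Lemma Re_cube_root (z : R[i]) : z ^+ 3 = 1 -> (z^*%C * z = 1) ->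
  - 2^-1 <= complex.Re z.
Proof.
case: z => a b /eqP + /eqP; rewrite !exprS expr0 !eq_complex /=.
move=> /andP[/eqP h _] /andP[/eqP h' _]; rewrite leNgt; apply/negP => a2.
have bb : b * b = 1 - a * a by lra.
have h3 : (a - 1) * (2 * a + 1) ^+ 2 = 0.
  have : a * (a * a) - 3 * a * (b * b) = 1 by rewrite -[RHS]h; ring.
  rewrite bb => h4.
  have -> : (a - 1) * (2 * a + 1) ^+ 2 = a * (a * a) - 3 * a * (1 - a * a) - 1.
    by ring.
  by rewrite h4 subrr.
move/eqP: h3; rewrite mulf_eq0 sqrf_eq0 => /orP[] /eqP; lra.
Qed.

Lemma eigen_ge_char3 (A : {set V}) (x : V) : p = 3%N ->
  - (#|A|%:R / 2) <= eigen R A x.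
Proof.
move=> p3; have chi_ge y : - 2^-1 <= complex.Re (chi R x y).
  apply: Re_cube_root; last first.
    by rewrite /chi conjc_addchar // addcharNK.
  by rewrite /chi /addchar -exprM mulnC exprM -p3 zeta_expr_p ?prime_gt0 // expr1n.
have -> : eigen R A x = \sum_(y in A) complex.Re (chi R x y).
  rewrite /eigen /eigenC; apply: (big_morph (@complex.Re R)) => // a b.
  by case: a; case: b.
rewrite -mulrN mulr_natl -sumr_const.
by apply: ler_sum => y _.
Qed.

(* Here [p = 3] and the last level set is empty. The two other eigenvalue
   functions are at least [-2] and add up to [-1], so [(l - 1) * (l + 2) <= 0]
   off [0], while these products add up to [0]. *)
Lemma level_eigenvalues_9 (i : 'I_p.+1) (x : V) :
  N = -3 -> (0 < i)%N -> x != 0 ->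
  (eigen R (D i) x + (q + (i == p :> nat)%:Z)%:~R) *
  (eigen R (D i) x + (q + (i == p :> nat)%:Z)%:~R - N%:~R) = 0.
Proof.
move=> N3 i0 x0; have [p3 q1] : p = 3%N /\ q = -1.
  have [h|[h|h]] : q >= 1 \/ q = -1 \/ q <= -2 by clear - q0; lia.
  - by exfalso; clear - h p_gt2 N3; nia.
  - by split=> //; rewrite h in N3; lia.
  - by exfalso; clear - h p_gt2 N3; nia.
have K (k : 'I_p.+1) : (0 < k)%N -> #|D k| = (if k == p :> nat then 0 else 4)%N.
  move=> /degD; rewrite N3 q1; case: eqP => _ /=; lia.
have [ip|ip] := eqVneq (i : nat) p.
  have /eqP := K i i0; rewrite ip eqxx cards_eq0 => /eqP Di.
  by rewrite /eigen /eigenC Di big_set0 q1 /=; ring.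
have Ki : #|D i| = 4%N by rewrite K // (negbTE ip).
rewrite addr0 N3 q1.
have lb (k : 'I_p.+1) (y : V) : (0 < k)%N -> -2 <= eigen R (D k) y.
  move=> k0; apply: le_trans (eigen_ge_char3 _ _ p3); rewrite K //.
  by case: eqP => _; lra.
pose l := eigen R (D i).
have le0 (y : V) : y != 0 -> (l y - 1) * (l y + 2) <= 0.
  (* The upper bound comes from the other nonempty class [D j]: its eigenvalue is at least -2 and
     the two add up to -1. *)
  move=> y0; suff : l y <= 1.
    by have := lb i y i0; rewrite -/(l y) => h1 h2; nra.
  have := sum_eigen_level y0.
  have i_lt : (i < p)%N by have := ltn_ord i; lia.
  pose j : 'I_p.+1 := if i == 1%N :> nat then inord 2 else inord 1.
  have [j0 jp ij] : [/\ (0 < j)%N, (j < p)%N & i != j].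
    by rewrite -val_eqE /= /j; case: eqP => h; rewrite inordK; try split; lia.
  rewrite (bigD1 ord0) //= eigen_set1 //; rewrite (bigD1 i) /=; last by rewrite -lt0n.
  rewrite (bigD1 j) /=; last by rewrite -lt0n j0 eq_sym ij.
  rewrite big1 => [|k /andP[/andP[k0 ki] kj]]; last first.
    have kp : k = p :> nat.
      clear - k0 ki kj ij p3 i0 j0 i_lt jp; move: k0 ki kj ij (ltn_ord k).
      by rewrite -!val_eqE /=; clearbody j; lia.
    have /eqP : #|D k| = 0%N by rewrite K ?kp ?eqxx ?prime_gt0.
    rewrite cards_eq0 => /eqP Dk.
    by rewrite /eigen /eigenC Dk big_set0.
  by have := lb j y j0; rewrite -/(l y); lra.
(* Here [#|V| = 9] and [#|D i| = 4], so the sum is [9 * 4 + 0 - 2 * 9]. The term at 0 is already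
   [3 * 6 = 18], so the nonpositive terms off 0 all vanish. *)
have tot : \sum_y (l y - 1) * (l y + 2) = 18.
  transitivity (\sum_y (l y * l y + l y - 2)).
    by apply: eq_bigr => y _; ring.
  have sDi := symset_level i; have zDi := zero_notin_level i0.
  rewrite !big_split /= sum_eigenM // sum_eigen //.
  by rewrite finset.setIid Ki sumr_const -[(- 2) *+ _]mulr_natr !card_vR N3; ring.
have l00 : (l 0 - 1) * (l 0 + 2) = 18 by rewrite /l eigen0 // Ki; ring.
rewrite (bigD1 0) //= l00 in tot.
have tot0 : \sum_(y | y != 0) - ((l y - 1) * (l y + 2)) = 0 by rewrite sumrN; lra.
have := psumr_eq0P _ tot0 => /(_ _ x x0).
rewrite -/(l x) => h.
have -> : (l x + (-1)%:~R) * (l x + (-1)%:~R - (-3)%:~R) = (l x - 1) * (l x + 2) by ring.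
by apply/eqP; rewrite -oppr_eq0 h // => y y0; rewrite oppr_ge0 le0.
Qed.

Lemma level_eigenvalues (i : 'I_p.+1) (x : V) : (0 < i)%N -> x != 0 ->
  (eigen R (D i) x + (q + (i == p :> nat)%:Z)%:~R) *
  (eigen R (D i) x + (q + (i == p :> nat)%:Z)%:~R - N%:~R) = 0.
Proof.
have [/level_eigenvalues_9|/level_eigenvalues_generic] := eqVneq N (-3); exact.
Qed.

Lemma sum_ord_last (S : pzRingType) (g : nat -> S) :
  \sum_(i < p) g i.+1 * (i.+1 == p)%:R = g p.
Proof.
case: p (prime_gt0 p_prime) => // k _; rewrite big_ord_recr /= eqxx mulr1.
by rewrite big1 ?add0r // => i _; rewrite eqSS ltn_eqF ?mulr0 // ltn_ord.
Qed.

Lemma sum_zeta : \sum_(i < p) zeta R p ^+ i.+1 = 0.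
Proof.
under eq_bigr => i _ do rewrite exprS.
rewrite -mulr_sumr; have := subrX1 (zeta R p) p.
rewrite zeta_expr_p ?prime_gt0 // subrr => /esym/eqP.
by rewrite mulf_eq0 subr_eq0 (negbTE (zeta_neq1 _ _)) //= => /eqP->; rewrite mulr0.
Qed.

(* For [x != 0] exactly one [eigen R (D i) x] is [N - r i] and the others are
   [- r i], because they add up to [-1] while the [r i] add up to [N + 1]. *)
Lemma walsh_value (x : V) : exists k : nat, walsh R f x = N%:~R * zeta R p ^+ k.
Proof.
pose r (i : nat) : R[i] := (q + (i == p)%:Z)%:~R.
have rE i : r i = q%:~R + (i == p)%:R by rewrite /r rmorphD.
(* The constant part [q] is killed by the vanishing sum of the roots of unity; the extra 1 at index
   [p] contributes [zeta R p ^+ p]. *)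
have sumzr : \sum_(i < p) zeta R p ^+ i.+1 * r i.+1 = 1.
  under eq_bigr => i _ do rewrite rE mulrDr.
  rewrite big_split /= -mulr_suml sum_zeta mul0r add0r.
  by rewrite (sum_ord_last (fun i => zeta R p ^+ i)) zeta_expr_p ?prime_gt0.
have sumr : \sum_(i < p) r i.+1 = N%:~R + 1.
  under eq_bigr => i _ do rewrite rE -[(_ == _)%:R]mul1r.
  rewrite big_split /= (sum_ord_last (fun=> 1)) sumr_const card_ord.
  by rewrite rmorphM /= mulr_natr.
pose e (i : 'I_p) : R[i] := ((eigen R (D (lift ord0 i)) x)%:C)%C.
have WE : walsh R f x = 1 + \sum_(i < p) zeta R p ^+ i.+1 * e i.
  by rewrite walsh_level // big_ord_recl /= eigen_set1 // expr0 mulr1.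
have [x0|x0] := eqVneq x 0.
  exists 0%N; rewrite WE expr0 mulr1.
  have eE i : e i = (N%:~R - 1) * r i.+1.
    rewrite /e x0 eigen0 degDR //= rmorphM rmorphB /= !rmorph_int.
    by [].
  under eq_bigr => i _ do rewrite eE mulrCA.
  by rewrite -mulr_sumr sumzr; ring.
(* [u] marks the indices whose eigenvalue is [N - r i] rather than [- r i]. *)
pose u (i : 'I_p) := e i != - r i.+1.
have eE i : e i = N%:~R * (u i)%:R - r i.+1.
  rewrite /u; case: (eqVneq (e i) (- r i.+1)) => [->|ne] /=.
    by rewrite mulr0 sub0r.
  have : (e i + r i.+1) * (e i + r i.+1 - N%:~R) = 0.
    have /(congr1 (fun z : R => (z%:C)%C)) := @level_eigenvalues (lift ord0 i) x isT x0.
    by rewrite rmorphM rmorphB rmorphD /= !rmorph_int.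
  move/eqP; rewrite mulf_eq0 addr_eq0 (negbTE ne) /= => /eqP h.
  by rewrite -[LHS]subr0 -h; ring.
have Nn0 : (N%:~R : R[i]) != 0.
  by rewrite intr_eq0 mulf_neq0 // -lt0n prime_gt0.
have su : \sum_(i < p) (u i)%:R = #|[set i | u i]|%:R :> R[i].
  rewrite -sumr_const [RHS]big_mkcond; apply: eq_bigr => i _.
  by rewrite inE; case: (u i).
have cu : #|[set i | u i]| = 1%N.
  have : 1 + \sum_(i < p) e i = 0.
    have /(congr1 (fun z : R => (z%:C)%C)) := sum_eigen_level x0.
    by rewrite rmorph_sum /= big_ord_recl eigen_set1.
  under eq_bigr => i _ do rewrite eE.
  rewrite big_split /= sumrN sumr -mulr_sumr su => h.
  have /eqP : N%:~R * (#|[set i | u i]|%:R - 1) = 0 :> R[i] by rewrite -[RHS]h; ring.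
  by rewrite mulf_eq0 (negbTE Nn0) subr_eq0 pnatr_eq1 => /eqP.
have /cards1P[k ku] : #|[set i | u i]| == 1%N by rewrite cu.
(* The ordinal [k] stands for the level [k.+1]. The term 1 of the zero vector cancels against the
   sum of the [zeta ^ i r i]. *)
exists k.+1; rewrite WE.
under eq_bigr => i _ do rewrite eE mulrBr.
rewrite big_split /= sumrN sumzr (bigD1 k) //= big1 => [|i ik].
  have -> : u k by move/setP/(_ k): ku; rewrite !inE eqxx.
  by rewrite mulr1; ring.
have /negbTE-> : ~~ u i by move/setP/(_ i): ku; rewrite !inE (negbTE ik) => ->.
by rewrite !mulr0.
Qed.

End LevelSets.

(** * From feasible degrees to bentness *)

Lemma card_level_degree (p n : nat) (f : 'rV['F_p]_n -> 'F_p) (i : 'I_p.+1) :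
  prime p -> (forall x, f (- x) = f x) -> f 0 = 0 -> (0 < i)%N ->
  #|[set y | component_graph f i 0 y]| = #|level_set f i|.
Proof.
move=> p_prime f_even f0 i0; apply: eq_card => y.
rewrite inE /component_graph sub0r symset_level //.
have [<-|//] := eqVneq 0 y.
by rewrite (negbTE (zero_notin_level p_prime f0 i0)).
Qed.

(** As [m] is positive, [N / p] is an integer [q], namely plus or minus [p ^ (m - 1)], so the
    rational degree conditions become integral. *)
Lemma feasible_degrees_int (p m : nat) (f : 'rV['F_p]_(2 * m) -> 'F_p) :
  prime p -> (0 < m)%N -> (forall x, f (- x) = f x) -> f 0 = 0 ->
  feasible_degrees f ->
  exists q : int, `|q * p%:Z| = p%:Z ^+ m /\
    forall i : 'I_p.+1, (0 < i)%N ->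
      #|level_set f i|%:Z = (q * p%:Z - 1) * (q + (i == p :> nat)%:Z).
Proof.
move=> p_prime m_gt0 f_even f0 [N [NE deg]].
have p0 : (p%:R : rat) != 0 by rewrite pnatr_eq0 -lt0n prime_gt0.
have [q qE qN] : exists2 q : int, N = (q * p%:Z)%:~R & `|q * p%:Z| = p%:Z ^+ m.
  have pm : p%:Z ^+ m = p%:Z ^+ m.-1 * p%:Z by rewrite -exprSr prednK.
  case: NE => ->; [exists (p%:Z ^+ m.-1) | exists (- p%:Z ^+ m.-1)];
    rewrite ?mulNr -?pm ?normrN ?ger0_norm ?exprn_ge0 //.
  - by rewrite rmorphXn.
  - by rewrite rmorphN rmorphXn.
exists q; split=> // i i0; apply: (@intr_inj rat).
have := deg i i0 0; rewrite card_level_degree // => h.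
rewrite [LHS]h qE [RHS]rmorphM rmorphB /=; congr (_ * _).
rewrite /feasible_ratio rmorphM /= mulfK // rmorphD /=.
have [ip|ip] := ltnP i p; first by rewrite ltn_eqF // addr0.
by rewrite (_ : (i == p :> nat)) // eqn_leq ip -ltnS ltn_ord.
Qed.

Theorem theorem8p5 (R : realType) (p m : nat) (f : 'rV['F_p]_(2 * m) -> 'F_p)
  (p_prime : prime p) (p_gt2 : (2 < p)%N) (m_gt0 : (0 < m)%N)
  (f_even : forall x, f (- x) = f x) (f0 : f 0 = 0)
  (f_feasible : feasible_degrees f)
  (f_amorphic : amorphic (level_rel f)) :
  bent R f.
Proof.
move=> x.
have [q [qN deg]] := feasible_degrees_int p_prime m_gt0 f_even f0 f_feasible.
have q0 : q != 0.
  apply: contra_eq_neq qN => ->; rewrite mul0r normr0 eq_sym expf_neq0 //.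
  by rewrite -lt0n prime_gt0.
have card_v : (#|{: 'rV['F_p]_(2 * m)}|)%:Z = (q * p%:Z) ^+ 2.
  rewrite -[RHS]real_normK ?num_real // qN card_mx card_Fp // mul1n.
  by rewrite -exprM [(m * 2)%N]mulnC -[p%:Z]natz -natrX natz.
have [k ->] := walsh_value R p_prime p_gt2 f_even f0 f_amorphic q0 card_v deg x.
rewrite normrM normrX norm_zeta expr1n mulr1 -intr_norm qN.
by rewrite rmorphXn.
Qed.
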